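(* Let $(X,\zeta)_\xi$ and $(X',\zeta')_\xi$ be soft topological spaces with the same parameter set $\xi$, let $A\subseteq X$, and let $\varrho\colon X\to X'$ be a function such that $(\mathbb{I}_\xi,\varrho)\colon(X,\zeta)_\xi\to(X',\zeta')_\xi$ is soft continuous. If the soft subspace $(A,\zeta_A)_\xi$ is soft path connected, then the soft subspace $(\varrho(A),\zeta'_{\varrho(A)})_\xi$ is also soft path connected.
   Context: A soft set over a set $X$ with parameter set $\xi$ is a function $W\colon\xi\to\mathcal{P}(X)$. Soft union, soft intersection and soft inclusion $\widetilde{\sqsubseteq}$ of soft sets with parameter set $\xi$ are taken parameterwise; $\emptyset_\xi(e)=\emptyset$ and $X_\xi(e)=X$ for all $e\in\xi$. For $x\in X$, $x\,\widetilde{\in}\,W$ means $x\in W(e)$ for every $e\in\xi$. A soft topology $\zeta$ on $X$ with parameter set $\xi$ is a collection of soft sets over $X$ (with parameter set $\xi$) containing $\emptyset_\xi$ and $X_\xi$ and closed under arbitrary soft unions and under soft intersections of two members; $(X,\zeta)_\xi$ is a soft topological space and members of $\zeta$ are soft open. A soft open neighborhood of $x$ is a $W\in\zeta$ with $x\,\widetilde{\in}\,W$. For $A\subseteq X$, the soft subspace $(A,\zeta_A)_\xi$ has $\zeta_A=\{W_A:W\in\zeta\}$, $W_A(e)=W(e)\cap A$. For a function $\varrho\colon X\to X'$, put $\varrho(W)(e)=\varrho(W(e))$. The mapping $(\mathbb{I}_\xi,\varrho)\colon(X,\zeta)_\xi\to(X',\zeta')_\xi$ is soft continuous if for every $x\in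 X$ and every soft open neighborhood $W'$ of $\varrho(x)$ there is a soft open neighborhood $W$ of $x$ with $\varrho(W)\,\widetilde{\sqsubseteq}\,W'$. The soft usual topology on $\mathbb{R}$ with parameter set $\xi$ is $\mathscr{U}_\xi=\{H^G_\xi: G\subseteq\mathbb{R}\text{ open in the usual topology}\}$, where $H^G_\xi(e)=G$ for all $e\in\xi$; $(I,(\mathscr{U}_\xi)_I)$ is its soft subspace on $I=[0,1]$ (with parameter set $\xi$). A soft path from $x$ to $y$ in $(X,\zeta)_\xi$ is a soft continuous mapping $\Gamma=(\mathbb{I}_\xi,\gamma)\colon(I,(\mathscr{U}_\xi)_I)\to(X,\zeta)_\xi$, where $\gamma\colon I\to X$ is a function with $\gamma(0)=x$, $\gamma(1)=y$. $(X,\zeta)_\xi$ is soft path connected if for all $x,y\in X$ there is a soft path from $x$ to $y$. *)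

(* Defs.v *)
From mathcomp Require Import all_boot all_order all_algebra.
From mathcomp Require Import boolp classical_sets set_interval reals topology normedtype.
Import numFieldNormedType.Exports.

Set Implicit Arguments.
Unset Strict Implicit.
Unset Printing Implicit Defensive.

Import Order.TTheory GRing.Theory Num.Theory.
Local Open Scope classical_set_scope.
Local Open Scope ring_scope.

Definition soft_set (xi X : Type) := xi -> set X.

Section SoftSets.
Context {xi X : Type}.
Implicit Types (V W : soft_set xi X) (F : set (soft_set xi X)).

Definition soft_set0 : soft_set xi X := fun=> set0.
Definition soft_setT : soft_set xi X := fun=> setT.
Definition soft_bigcup F : soft_set xi X := fun e => \bigcup_(W in F) W e.
Definition soft_setI V W : soft_set xi X := fun e => V e `&` W e.
Definition soft_subset V W : Prop := forall e, V e `<=` W e.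
Definition soft_mem (x : X) W : Prop := forall e, W e x.

End SoftSets.

Record soft_topology (xi X : Type) := SoftTopology {
  soft_open : set (soft_set xi X);
  soft_open0 : soft_open soft_set0;
  soft_openT : soft_open soft_setT;
  soft_open_bigcup : forall F, F `<=` soft_open -> soft_open (soft_bigcup F);
  soft_openI : forall V W,
    soft_open V -> soft_open W -> soft_open (soft_setI V W)
}.

Definition soft_open_nbhd (xi X : Type) (zeta : soft_topology xi X)
    (x : X) (W : soft_set xi X) : Prop :=
  soft_open zeta W /\ soft_mem x W.

(* Subspaces live on the subtype {x : X | x \in A} to which a set A coerces, so
   that W e `&` A, seen as a subset of A, is the preimage of W e under val. *)
Definition soft_trace (xi X : Type) (A : set X) (W : soft_set xi X) :
    soft_set xi A :=
  fun e => [set a : A | W e (val a)].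
Arguments soft_trace {xi X} A W.

Section SoftSubspace.
Context {xi X : Type} (zeta : soft_topology xi X) (A : set X).

Let sub_open : set (soft_set xi A) := [set soft_trace A W | W in soft_open zeta].

Fact soft_subspace_open0 : sub_open soft_set0.
Proof. by exists soft_set0 => //; exact: soft_open0. Qed.

Fact soft_subspace_openT : sub_open soft_setT.
Proof. by exists soft_setT => //; exact: soft_openT. Qed.

Fact soft_subspace_open_bigcup (F : set (soft_set xi A)) :
  F `<=` sub_open -> sub_open (soft_bigcup F).
Proof.
move=> FA; exists (soft_bigcup [set W | soft_open zeta W /\ F (soft_trace A W)]).
  by apply: soft_open_bigcup => W [].
apply/funext => e; apply/seteqP; split => a /=.
  by move=> [W [_ FW] Wa]; exists (soft_trace A W).
by move=> [V FV Va]; have [W zW WV] := FA _ FV; subst V; exists W.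
Qed.

Fact soft_subspace_openI (V W : soft_set xi A) :
  sub_open V -> sub_open W -> sub_open (soft_setI V W).
Proof.
move=> [V' zV <-] [W' zW <-]; exists (soft_setI V' W') => //.
exact: soft_openI.
Qed.

Definition soft_subspace : soft_topology xi A :=
  SoftTopology soft_subspace_open0 soft_subspace_openT
    soft_subspace_open_bigcup soft_subspace_openI.

End SoftSubspace.

Definition soft_image (xi X X' : Type) (rho : X -> X') (W : soft_set xi X) :
    soft_set xi X' :=
  fun e => rho @` W e.

(* Soft continuity of the mapping (id_xi, rho). *)
Definition soft_continuous (xi X X' : Type) (zeta : soft_topology xi X)
    (zeta' : soft_topology xi X') (rho : X -> X') : Prop :=
  forall (x : X) (W' : soft_set xi X'), soft_open_nbhd zeta' (rho x) W' ->
    exists2 W : soft_set xi X,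
      soft_open_nbhd zeta x W & soft_subset (soft_image rho W) W'.

Section SoftUsual.
Context (R : realType) (xi : Type).

Definition soft_const (G : set R) : soft_set xi R := fun=> G.

Let usual_open : set (soft_set xi R) := [set soft_const G | G in open].

Fact soft_usual_open0 : usual_open soft_set0.
Proof. by exists set0 => //; exact: open0. Qed.

Fact soft_usual_openT : usual_open soft_setT.
Proof. by exists setT => //; exact: openT. Qed.

Fact soft_usual_open_bigcup (F : set (soft_set xi R)) :
  F `<=` usual_open -> usual_open (soft_bigcup F).
Proof.
move=> FU; exists (\bigcup_(G in [set G | open G /\ F (soft_const G)]) G).
  by apply: bigcup_open => G [].
apply/funext => e; apply/seteqP; split => a /=.
  by move=> [G [_ FG] Ga]; exists (soft_const G).
by move=> [V FV Va]; have [G oG GV] := FU _ FV; subst V; exists G.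
Qed.

Fact soft_usual_openI (V W : soft_set xi R) :
  usual_open V -> usual_open W -> usual_open (soft_setI V W).
Proof. by move=> [G oG <-] [H oH <-]; exists (G `&` H) => //; exact: openI. Qed.

Definition soft_usual : soft_topology xi R :=
  SoftTopology soft_usual_open0 soft_usual_openT
    soft_usual_open_bigcup soft_usual_openI.

End SoftUsual.

Section UnitInterval.
Context (R : realType).

Definition unit_itv : set R := `[0, 1].

Fact unit_itv0_subproof : (0 : R) \in unit_itv.
Proof. by apply/mem_set; rewrite /unit_itv /= in_itv /= lexx ler01. Qed.

Fact unit_itv1_subproof : (1 : R) \in unit_itv.
Proof. by apply/mem_set; rewrite /unit_itv /= in_itv /= lexx ler01. Qed.

Definition unit_itv0 : unit_itv := exist _ 0 unit_itv0_subproof.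
Definition unit_itv1 : unit_itv := exist _ 1 unit_itv1_subproof.

End UnitInterval.
Arguments unit_itv R : clear implicits.

Definition soft_path (R : realType) (xi X : Type) (zeta : soft_topology xi X)
    (x y : X) (gamma : unit_itv R -> X) : Prop :=
  [/\ soft_continuous (soft_subspace (soft_usual R xi) (unit_itv R)) zeta gamma,
      gamma (unit_itv0 R) = x & gamma (unit_itv1 R) = y].

Definition soft_path_connected (R : realType) (xi X : Type)
    (zeta : soft_topology xi X) : Prop :=
  forall x y : X, exists gamma : unit_itv R -> X, soft_path zeta x y gamma.

(* Main.v *)
Require Import Defs.
From mathcomp Require Import all_boot all_order all_algebra.
From mathcomp Require Import boolp classical_sets reals topology normedtype.
Local Open Scope classical_set_scope.

(** A soft path is a soft continuous map out of the unit interval, so composing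
    it with a soft continuous map [f] gives a soft path between the images of
    its endpoints ([soft_path_comp]). Hence a soft continuous surjection carries
    soft path connectedness from its source to its target
    ([soft_path_connected_surjective]). The theorem applies this to the map from
    [A] onto [rho @` A] that [rho] induces: it is onto by construction, and it is
    soft continuous because the trace on [A] of a neighborhood that works for
    [rho] works for the induced map ([soft_continuous_subspace]). *)

Lemma soft_continuous_comp (xi X Y Z : Type) (zX : soft_topology xi X)
    (zY : soft_topology xi Y) (zZ : soft_topology xi Z)
    (f : X -> Y) (g : Y -> Z) :
  soft_continuous zX zY f -> soft_continuous zY zZ g ->
  soft_continuous zX zZ (g \o f).
Proof.
move=> cf cg x W /cg [V /cf [U nU fUV] gVW].
exists U => // e _ [u Uu <-]; apply: gVW.
by exists (f u) => //; apply: fUV; exists u.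
Qed.

(** Points of [A] and [B] are points of subtypes, so a map between them that
    acts as [rho] is a separate function [g], tied to [rho] by the projections. *)
Lemma soft_continuous_subspace (xi X X' : Type) (zeta : soft_topology xi X)
    (zeta' : soft_topology xi X') (A : set X) (B : set X') (rho : X -> X')
    (g : A -> B) :
  (forall a : A, val (g a) = rho (val a)) ->
  soft_continuous zeta zeta' rho ->
  soft_continuous (soft_subspace zeta A) (soft_subspace zeta' B) g.
Proof.
move=> gE crho a _ [[V oV <-] Va].
have nV : soft_open_nbhd zeta' (rho (val a)) V.
  by split=> // e; rewrite -gE; exact: Va.
have [W [oW Wa] rhoWV] := crho _ _ nV.
exists (soft_trace A W); first by split; [exists W | exact: Wa].
move=> e _ [b Wb <-]; rewrite /soft_trace /= gE.
by apply: rhoWV; exists (val b).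
Qed.

Lemma soft_path_comp (R : realType) (xi X Y : Type) (zX : soft_topology xi X)
    (zY : soft_topology xi Y) (f : X -> Y) (x y : X) (gamma : unit_itv R -> X) :
  soft_continuous zX zY f -> soft_path zX x y gamma ->
  soft_path zY (f x) (f y) (f \o gamma).
Proof.
move=> cf [cgamma gamma0 gamma1]; split; last 2 first.
- by rewrite /= gamma0.
- by rewrite /= gamma1.
exact: soft_continuous_comp cgamma cf.
Qed.

Lemma soft_path_connected_surjective (R : realType) (xi X Y : Type)
    (zX : soft_topology xi X) (zY : soft_topology xi Y) (f : X -> Y) :
  (forall y, exists x, f x = y) -> soft_continuous zX zY f ->
  soft_path_connected R zX -> soft_path_connected R zY.
Proof.
move=> fsurj cf pcX y1 y2.
have [[x1 <-] [x2 <-]] := (fsurj y1, fsurj y2).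
have [gamma pgamma] := pcX x1 x2.
by exists (f \o gamma); exact: soft_path_comp cf pgamma.
Qed.

Lemma mem_image_val (X X' : Type) (A : set X) (rho : X -> X') (a : A) :
  rho (val a) \in rho @` A.
Proof. by apply/mem_set; exists (val a) => //; exact: set_mem (valP a). Qed.

Definition to_image (X X' : Type) (A : set X) (rho : X -> X') (a : A) :
  rho @` A := exist _ (rho (val a)) (mem_image_val X X' A rho a).

Lemma to_image_surj (X X' : Type) (A : set X) (rho : X -> X')
    (b : rho @` A) : exists a : A, to_image X X' A rho a = b.
Proof.
have [x Ax rhox] := set_mem (valP b).
by exists (exist _ x (mem_set Ax)); apply: val_inj.
Qed.

Theorem theorem4p10 (R : realType) (xi X X' : Type)
    (zeta : soft_topology xi X) (zeta' : soft_topology xi X')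
    (A : set X) (rho : X -> X')
    (rho_continuous : soft_continuous zeta zeta' rho)
    (A_connected : soft_path_connected R (soft_subspace zeta A)) :
  soft_path_connected R (soft_subspace zeta' (rho @` A)).
Proof.
apply: soft_path_connected_surjective A_connected.
  exact: to_image_surj.
exact: soft_continuous_subspace rho_continuous.
Qed.
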